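(* Assume that, under model $M_j$ (true rank $k=j$), the top eigenvalues $\ell_1\ge\ell_2\ge\cdots$ of $X$ satisfy $\ell_i \to \psi_{\sigma}(\lambda_i)$ almost surely for $1 \le i \le j$ and $\ell_i \to 2\sigma$ almost surely for $j < i \le q$, where $\psi_\sigma(x)=x+\sigma^2/x$. Regardless of whether $\sigma$ is known or unknown, under the assumption that $q$ and the eigenvalues of $A$ are fixed (do not change with $N$), we have: (a) If $\gamma \le 2$, then almost surely, $\liminf_{N \to \infty} \hat{k}_{\gamma} \ge k$. (b) If $\gamma > 2$, then almost surely, $\limsup_{N \to \infty} \hat{k}_{\gamma} \le k$. (c) Further, if $\lambda_k > \lambda_{\gamma} := \psi_{\sigma}^{-1}(\sqrt{2\gamma}\sigma)$, then for $\gamma > 2$, $\liminf_{N \to \infty} \hat{k}_{\gamma} \ge k$. As a consequence, if $\lambda_k > \lambda_{\gamma}$ (and $\gamma>2$), then $\hat{k}_{\gamma}$ is strongly consistent for $k$, i.e. $\hat k_\gamma \to k$ almost surely.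
   Context: Spiked GOE model $X = A + \sigma G$, where $G$ is an $N\times N$ GOE matrix (symmetric, upper-diagonal entries i.i.d. $\mathcal N(0,1/N)$, diagonal entries i.i.d. $\mathcal N(0,2/N)$), and $A=\sum_{i=1}^k\lambda_i u_iu_i^\top$ is positive semi-definite of rank $k$ with $\lambda_1\ge\cdots\ge\lambda_k>\sigma$ (the BBP threshold). Let $\ell_1\ge\cdots\ge\ell_N$ be the eigenvalues of $X$. Candidate models $M_0,\dots,M_q$, where under $M_j$ the rank is $j$. $\psi_\sigma(x)=x+\sigma^2/x$, which is strictly increasing on $(\sigma,\infty)$ with $\psi_\sigma(\sigma)=2\sigma$. The generalised AIC scores are: for known $\sigma$, $\mathrm{GAIC}_\gamma(j) = -2\log C_N + \frac{N(N+1)}{2}\log\sigma^2 + \frac{N}{2\sigma^2}\sum_{i>j}\ell_i^2 + \gamma\big(Nj - \frac{j(j-1)}{2}\big)$; for unknown $\sigma$, with $\hat{\sigma}^2_j = \frac{1}{N+1}\sum_{i>j}\ell_i^2$, $\mathrm{GAIC}_\gamma(j) = -2\log C_N + \frac{N(N+1)}{2}\log\hat\sigma^2_j + \frac{N}{2\hat\sigma^2_j}\sum_{i>j}\ell_i^2 + \gamma\big(1+Nj - \frac{j(j-1)}{2}\big)$, where $C_N$ is the normalising constant of the GOE-type density. These are $-2\times$(maximised log-likelihood) $+\gamma\times$(number of parameters). The estimator $\hat k_\gamma$ is the minimiser of $\mathrm{GAIC}_\gamma(j)$ over $j\in\{0,1,\dots,q\}$. *)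

(* Defs.v *)
From HB Require Import structures.
From mathcomp Require Import all_boot all_order all_algebra.
From mathcomp Require Import all_classical all_reals all_analysis.
From mathcomp Require Import normal_distribution.

Set Implicit Arguments.
Unset Strict Implicit.
Unset Printing Implicit Defensive.

Import Order.TTheory GRing.Theory Num.Theory.
Import numFieldNormedType.Exports.

Local Open Scope classical_set_scope.
Local Open Scope ring_scope.

Section SpikedGOE.
Context {R : realType}.

Definition psi (sigma x : R) : R := x + sigma ^+ 2 / x.

(* inverse of psi_sigma : (sigma, +oo) -> (2 sigma, +oo); for c >= 2 sigma,
   psi_inv sigma c is the unique x >= sigma with psi sigma x = c *)
Definition psi_inv (sigma c : R) : R := (c + Num.sqrt (c ^+ 2 - 4 * sigma ^+ 2)) / 2.

Definition lambda_gamma (sigma gamma : R) : R :=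
  psi_inv sigma (Num.sqrt (2 * gamma) * sigma).

Definition mutually_independent {d} {T : measurableType d} (P : probability T R)
  {I : finType} (D : pred I) (X : I -> T -> R) : Prop :=
  forall (S : {set I}), S \subset D ->
  forall B : I -> set R, (forall i, measurable (B i)) ->
  P (\big[setI/setT]_(i in S) (X i @^-1` B i)) =
  (\prod_(i in S) P (X i @^-1` B i))%E.

(* G : T -> 'M_N is an N x N GOE matrix: symmetric, entries measurable,
   upper-diagonal entries (i <= j) mutually independent,
   off-diagonal ~ N(0, 1/N), diagonal ~ N(0, 2/N)
   (normal_prob m s has mean m and standard deviation s). *)
Definition is_GOE {d} {T : measurableType d} (P : probability T R) (N : nat)
  (G : T -> 'M[R]_N) : Prop :=
  [/\ forall w, (G w)^T = G w,
      forall i j, measurable_fun setT (fun w => G w i j),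
      mutually_independent P [pred p : 'I_N * 'I_N | (p.1 <= p.2)%N]
        (fun p w => G w p.1 p.2),
      forall i j, i != j -> forall B : set R, measurable B ->
        P ((fun w => G w i j) @^-1` B) = normal_prob 0 (Num.sqrt (1 / N%:R)) B
    & forall i, forall B : set R, measurable B ->
        P ((fun w => G w i i) @^-1` B) = normal_prob 0 (Num.sqrt (2 / N%:R)) B].

Definition spike (N k : nat) (lam : nat -> R) (u : 'I_k -> 'cV[R]_N) : 'M[R]_N :=
  \sum_(i < k) lam i *: (u i *m (u i)^T).

Definition sorted_eigenvalues (N : nat) (M : 'M[R]_N) (l : nat -> R) : Prop :=
  (forall i j, (i <= j < N)%N -> l j <= l i) /\
  char_poly M = \prod_(i < N) ('X - (l i)%:P).

(* sum_{i > j} ell_i^2 (1-indexed), i.e. sum_{j <= i < N} l i ^ 2 (0-indexed) *)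
Definition tailsq (N : nat) (l : nat -> R) (j : nat) : R :=
  \sum_(j <= i < N) l i ^+ 2.

(* normalising constant C_N of the GOE-type density of X:
   f(X) = C_N (sigma^2)^(-N(N+1)/4) exp(-N tr((X-A)^2) / (4 sigma^2)), with
   C_N = (N/(4 pi))^(N/2) (N/(2 pi))^(N(N-1)/4). It does not affect hat k. *)
Definition C_N (N : nat) : R :=
  powR (N%:R / (4 * pi)) (N%:R / 2) * powR (N%:R / (2 * pi)) ((N * N.-1)%:R / 4).

Definition nparams (N j : nat) : R := (N * j)%:R - (j * j.-1)%:R / 2.

Definition GAIC_known (N : nat) (sigma gamma : R) (l : nat -> R) (j : nat) : R :=
  - 2 * ln (C_N N) + (N * N.+1)%:R / 2 * ln (sigma ^+ 2)
  + N%:R / (2 * sigma ^+ 2) * tailsq N l j + gamma * nparams N j.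

Definition sigma2_hat (N : nat) (l : nat -> R) (j : nat) : R :=
  tailsq N l j / N.+1%:R.

Definition GAIC_unknown (N : nat) (gamma : R) (l : nat -> R) (j : nat) : R :=
  - 2 * ln (C_N N) + (N * N.+1)%:R / 2 * ln (sigma2_hat N l j)
  + N%:R / (2 * sigma2_hat N l j) * tailsq N l j + gamma * (1 + nparams N j).

Definition GAIC (known : bool) (N : nat) (sigma gamma : R) (l : nat -> R) (j : nat) : R :=
  if known then GAIC_known N sigma gamma l j else GAIC_unknown N gamma l j.

Definition is_GAIC_minimizer (known : bool) (N q : nat) (sigma gamma : R)
  (l : nat -> R) (kh : nat) : Prop :=
  (kh <= q)%N /\
  forall j, (j <= q)%N -> GAIC known N sigma gamma l kh <= GAIC known N sigma gamma l j.

End SpikedGOE.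

(* Main.v *)
(** Dividing GAIC(j+1) - GAIC(j) by N gives, in both versions of the score, a
    sequence with limit gamma - L_j^2 / (2 sigma^2), where L_j is the limit of
    the (j+1)-st eigenvalue. Comparing L_j with sqrt(2 gamma) sigma fixes the
    sign of the increments before and after k, hence the position of the
    minimiser. For unknown sigma the limit needs (1/N) sum_{i>j} l_i^2 -> sigma^2
    almost surely, which is not among the hypotheses and is proved from the GOE
    law: sum_i l_i^2 = tr X^2, the rank-k part contributes o(N), and
    tr G^2 / N -> 1 because Var(tr G^2) is bounded, so that the variances of
    tr G^2 / N are summable. *)
Require Import Defs.
From HB Require Import structures.
From mathcomp Require Import all_boot all_order all_algebra.
From mathcomp Require Import all_classical all_reals all_analysis.
From mathcomp Require Import normal_distribution measurable_realfun.
From mathcomp Require Import ring lra.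
Set Implicit Arguments.
Unset Strict Implicit.
Unset Printing Implicit Defensive.
Import Order.TTheory GRing.Theory Num.Theory.
Import numFieldNormedType.Exports.
Local Open Scope classical_set_scope.
Local Open Scope ring_scope.

(** * Gaussian moments and independence *)

Section gaussian_moments.
Context {R : realType}.
Local Notation mu := (@lebesgue_measure R).

(** The Radon-Nikodym derivative and [normal_pdf] have the same integral over every measurable set,
    so they agree almost everywhere. *)
Lemma ge0_integral_normal_prob (m s : R) (f : R -> \bar R) :
  measurable_fun setT f -> (forall x, 0 <= f x)%E ->
  (\int[normal_prob m s]_x f x = \int[mu]_x (f x * (normal_pdf m s x)%:E))%E.
Proof.
move=> mf f0.
have dom := normal_prob_dominates m s.
rewrite -(Radon_Nikodym_SigmaFinite.change_of_variables dom)//.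
have mD := measurable_int mu (Radon_Nikodym_SigmaFinite.f_integrable dom).
have mpdf : measurable_fun setT (fun x => (normal_pdf m s x)%:E).
  by apply/measurable_EFinP; exact: measurable_normal_pdf.
apply: ae_eq_integral => //.
- exact: emeasurable_funM.
- exact: emeasurable_funM.
- apply: ae_eqe_mul2l; apply: integral_ae_eq => //=.
  + exact: Radon_Nikodym_SigmaFinite.f_integrable.
  + by move=> E _ mE; rewrite -Radon_Nikodym_SigmaFinite.f_integral.
Qed.

Lemma measurable_expR_sqr (h : R) :
  measurable_fun setT (fun x : R => expR (h * x ^+ 2)).
Proof.
apply: measurableT_comp => //; exact: measurable_funM.
Qed.

(* The integrand tilts the N(0, s^2) density into s'/s times the N(0, s'^2) density. *)
Lemma integral_normal_prob_expR_sqr (s s' : R) : 0 < s -> 0 < s' ->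
  (\int[normal_prob 0 s]_x (expR ((s ^- 2 - s' ^- 2) / 2 * x ^+ 2))%:E
   = (s' / s)%:E)%E.
Proof.
move=> s0 s'0; rewrite ge0_integral_normal_prob; last 2 first.
- by apply/measurable_EFinP; exact: measurable_expR_sqr.
- by move=> x; rewrite lee_fin expR_ge0.
transitivity (\int[mu]_x ((s' / s)%:E * (normal_pdf 0 s' x)%:E))%E; last first.
  rewrite ge0_integralZl//.
  - by rewrite integral_normal_pdf mule1.
  - by apply/measurable_EFinP; exact: measurable_normal_pdf.
  - by move=> x _; rewrite lee_fin normal_pdf_ge0.
  - by rewrite lee_fin divr_ge0// ltW.
apply: eq_integral => x _; rewrite -!EFinM; congr EFin.
rewrite !normal_pdfE ?gt_eqF// /normal_peak /normal_fun.
have pk (t : R) : 0 < t ->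
    Num.sqrt (t ^+ 2 * pi *+ 2) = t * Num.sqrt (pi *+ 2) :> R.
  by move=> t0; rewrite -mulrnAr sqrtrM ?sqr_ge0// sqrtr_sqr gtr0_norm.
rewrite !pk// mulrCA -expRD.
have q0 : Num.sqrt (pi *+ 2) != 0 :> R.
  by rewrite gt_eqF// sqrtr_gt0 pmulrn_lgt0// pi_gt0.
rewrite [X in expR X](_ : _ = - (x - 0) ^+ 2 / (s' ^+ 2 *+ 2)); last first.
  by field; rewrite !gt_eqF.
by rewrite mulrA; congr (_ * _); field; rewrite q0 !gt_eqF.
Qed.

Lemma integral_normal_prob_cst (m s c : R) : 0 <= c ->
  (\int[normal_prob m s]_x c%:E = c%:E)%E.
Proof.
by move=> c0; rewrite integral_cst// [X in (_ * X)%E](probability_setT (normal_prob m s)) mule1.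
Qed.

Let msqr : measurable_fun setT (fun x : R => (x ^+ 2)%:E).
Proof. by apply/measurable_EFinP; exact: exprn_measurable. Qed.

(* Both bounds on the second moment integrate 1 + h x^2 <= exp (h x^2), with h of
   either sign; they meet as r -> 1. *)
Lemma normal_prob_sqr_ub (s r : R) : 0 < s -> 1 < r ->
  (\int[normal_prob 0 s]_x (x ^+ 2)%:E <= (s ^+ 2 * (2 * r ^+ 2 / (1 + r)))%:E)%E.
Proof.
move=> s0 r1.
have r0 : 0 < r by rewrite (lt_trans _ r1).
(* This tilt leads to standard deviation [r * s], so the exponential integrates to [r]. The
   resulting bound [(r - 1) / h] is the right-hand side of the statement. *)
pose h := (s ^- 2 - (r * s) ^- 2) / 2.
have hE : h = (r - 1) * (r + 1) / (2 * r ^+ 2 * s ^+ 2).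
  by rewrite /h; field; rewrite !gt_eqF.
have h0 : 0 < h by rewrite hE divr_gt0 ?mulr_gt0 ?exprn_gt0//; lra.
have : (\int[normal_prob 0 s]_x (1%:E + (h%:E * (x ^+ 2)%:E)) <= r%:E)%E.
  rewrite [leRHS](_ : _ = (r * s / s)%:E); last by rewrite mulfK ?gt_eqF.
  rewrite -integral_normal_prob_expR_sqr ?mulr_gt0//.
  apply: ge0_le_integral => //.
  - by move=> x _; rewrite adde_ge0// ?mule_ge0 ?lee_fin ?sqr_ge0// ltW.
  - by apply: emeasurable_funD => //; apply: emeasurable_funM.
  - by apply/measurable_EFinP; exact: measurable_expR_sqr.
  - by move=> x _; rewrite -EFinM -EFinD lee_fin expR_ge1Dx.
rewrite ge0_integralD//; last 2 first.
- by move=> x _; rewrite mule_ge0 ?lee_fin ?sqr_ge0// ltW.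
- exact: emeasurable_funM.
rewrite integral_normal_prob_cst// ge0_integralZl//; last 2 first.
- by move=> x _; rewrite lee_fin sqr_ge0.
- by rewrite lee_fin ltW.
rewrite -leeBrDl// -lee_pdivlMl// => /le_trans; apply.
rewrite -EFinB -EFinM lee_fin hE le_eqVlt; apply/orP; left; apply/eqP.
by field; rewrite ?gt_eqF//; lra.
Qed.

Lemma normal_prob_sqr_lb (s r : R) : 0 < s -> 0 < r < 1 ->
  ((s ^+ 2 * (2 * r ^+ 2 / (1 + r)))%:E <= \int[normal_prob 0 s]_x (x ^+ 2)%:E)%E.
Proof.
move=> s0 /andP[r0 r1].
pose h := (s ^- 2 - (r * s) ^- 2) / 2.
have hE : h = - ((1 - r) * (r + 1) / (2 * r ^+ 2 * s ^+ 2)).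
  by rewrite /h; field; rewrite !gt_eqF.
have h0 : 0 < - h by rewrite hE opprK divr_gt0 ?mulr_gt0 ?exprn_gt0//; lra.
(* Here [h] is negative; moving [h * x ^+ 2] to the other side keeps both integrands nonnegative. *)
have : (\int[normal_prob 0 s]_x 1%:E <=
    \int[normal_prob 0 s]_x ((expR (h * x ^+ 2))%:E + ((- h)%:E * (x ^+ 2)%:E)))%E.
  apply: ge0_le_integral => //.
  - apply: emeasurable_funD; last exact: emeasurable_funM.
    by apply/measurable_EFinP; exact: measurable_expR_sqr.
  - move=> x _; rewrite -EFinM -EFinD lee_fin.
    by rewrite mulNr lerBrDr expR_ge1Dx.
rewrite ge0_integralD//; last 3 first.
- by apply/measurable_EFinP; exact: measurable_expR_sqr.
- by move=> x _; rewrite mule_ge0 ?lee_fin ?sqr_ge0// ltW.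
- exact: emeasurable_funM.
rewrite integral_normal_prob_cst// ge0_integralZl//; last 2 first.
- by move=> x _; rewrite lee_fin sqr_ge0.
- by rewrite lee_fin ltW.
rewrite integral_normal_prob_expR_sqr ?mulr_gt0//.
rewrite -leeBlDl// -lee_pdivrMl// => H; apply: le_trans H.
rewrite -EFinB -EFinM lee_fin hE le_eqVlt; apply/orP; left; apply/eqP.
by field; rewrite ?gt_eqF//; lra.
Qed.

Lemma normal_prob_sqr (s : R) : 0 < s ->
  (\int[normal_prob 0 s]_x (x ^+ 2)%:E = (s ^+ 2)%:E)%E.
Proof.
move=> s0; set I := (\int[_]_x _)%E.
have I0 : (0 <= I)%E by apply: integral_ge0 => x _; rewrite lee_fin sqr_ge0.
have Ifin : I \is a fin_num.
  rewrite ge0_fin_numE//.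
  by apply: le_lt_trans (@normal_prob_sqr_ub s 2 s0 _) (ltry _); lra.
rewrite -(fineK Ifin); congr EFin.
have cvgr : s ^+ 2 * (2 * r ^+ 2 / (1 + r)) @[r --> (1:R)] --> s ^+ 2.
  rewrite [X in _ --> X](_ : _ = s ^+ 2 * (2 * 1 ^+ 2 / (1 + 1))); last by field.
  apply: cvgMr; apply: cvgM.
    by apply: cvgMr; apply: exprn_continuous.
  apply: cvgV; first by apply/eqP; lra.
  by apply: cvgD; [exact: cvg_cst|exact: cvg_id].
apply/eqP; rewrite eq_le; apply/andP; split.
- apply: (cvgr_to_ge (cvg_at_right_filter cvgr)).
  near=> r; rewrite -lee_fin fineK//; apply: normal_prob_sqr_ub => //.
- apply: (cvgr_to_le (cvg_at_left_filter cvgr)).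
  near=> r; rewrite -lee_fin fineK//; apply: normal_prob_sqr_lb => //.
  apply/andP; split => //; near: r; exact: nbhs_left_gt.
Unshelve. all: by end_near. Qed.

(** Only the order [s ^+ 4] matters later. Integrating [y ^+ 2 / 2 <= expR y] at [y = h * x ^+ 2],
    with the tilt that doubles [s], gives the factor [4 / h ^+ 2], that is 256/9 times [s ^+ 4]. *)
Lemma normal_prob_exp4_ub (s : R) : 0 < s ->
  (\int[normal_prob 0 s]_x (x ^+ 2 * x ^+ 2)%:E <= (29 * s ^+ 4)%:E)%E.
Proof.
move=> s0; pose h := (s ^- 2 - (2 * s) ^- 2) / 2.
have hE : h = 3 / (8 * s ^+ 2) by rewrite /h; field; rewrite !gt_eqF.
have h0 : 0 < h by rewrite hE divr_gt0 ?mulr_gt0 ?exprn_gt0.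
have m4 : measurable_fun setT (fun x : R => (x ^+ 2 * x ^+ 2)%:E).
  by apply/measurable_EFinP; exact: measurable_funM.
have : (\int[normal_prob 0 s]_x ((h ^+ 2 / 2)%:E * (x ^+ 2 * x ^+ 2)%:E) <= 2%:E)%E.
  rewrite [leRHS](_ : _ = (2 * s / s)%:E); last by rewrite mulfK ?gt_eqF.
  rewrite -integral_normal_prob_expR_sqr ?mulr_gt0//.
  apply: ge0_le_integral => //.
  - by move=> x _; rewrite -EFinM lee_fin -exprMn mulr_ge0 ?sqr_ge0// divr_ge0 ?sqr_ge0.
  - exact: emeasurable_funM.
  - by apply/measurable_EFinP; exact: measurable_expR_sqr.
  - move=> x _; rewrite -EFinM lee_fin.
    have hx0 : 0 <= h * x ^+ 2 by rewrite mulr_ge0 ?sqr_ge0 ?ltW.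
    apply: le_trans (expR_ge1Dxn 1 hx0).
    rewrite [leLHS](_ : _ = (h * x ^+ 2) ^+ 2 / 2`!%:R) ?lerDr//.
    by rewrite (_ : 2`! = 2)%N//; clearbody h; field.
rewrite ge0_integralZl//; last 2 first.
- by move=> x _; rewrite lee_fin -exprMn sqr_ge0.
- by rewrite lee_fin divr_ge0 ?sqr_ge0.
rewrite -lee_pdivlMl ?divr_gt0 ?exprn_gt0// => /le_trans; apply.
rewrite -EFinM lee_fin hE [leLHS](_ : _ = 256 / 9 * s ^+ 4); last first.
  by field; rewrite gt_eqF.
by rewrite ler_pM2r ?exprn_gt0//; lra.
Qed.

End gaussian_moments.

Section independence.
Context {d} {T : measurableType d} {R : realType} (P : probability T R).

(** Independence says that the joint law agrees with the product law on rectangles, hence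
    everywhere; Tonelli then separates the integrals. *)
Lemma ge0_integral_independent (X Y : {mfun T >-> R}) (f g : R -> \bar R) :
  (forall A B : set R, measurable A -> measurable B ->
    P (X @^-1` A `&` Y @^-1` B) = (P (X @^-1` A) * P (Y @^-1` B))%E) ->
  measurable_fun setT f -> measurable_fun setT g ->
  (forall x, 0 <= f x)%E -> (forall x, 0 <= g x)%E ->
  (\int[P]_w (f (X w) * g (Y w)) =
   \int[P]_w f (X w) * \int[P]_w g (Y w))%E.
Proof.
move=> XY mf mg f0 g0.
have mXY : measurable_fun setT (fun w => (X w, Y w)).
  exact: measurable_fun_pair.
pose XY_ : {mfun T >-> (R * R)%type} :=
  HB.pack (fun w => (X w, Y w)) (isMeasurableFun.Build _ _ _ _ _ mXY).
pose h (z : R * R) := (f z.1 * g z.2)%E.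
have mh : measurable_fun setT h.
  apply: emeasurable_funM.
    exact: measurableT_comp.
  exact: measurableT_comp.
have h0 z : (0 <= h z)%E by rewrite mule_ge0.
transitivity (\int[distribution P XY_]_z h z)%E.
  by rewrite ge0_integral_distribution.
transitivity (\int[(distribution P X \x distribution P Y)%E]_z h z)%E.
  apply: eq_measure_integral => A mA _.
  by apply/esym; apply: product_measure_unique => // B C mB mC; exact: XY.
rewrite fubini_tonelli1//.
transitivity (\int[distribution P X]_x (f x * \int[distribution P Y]_y g y))%E.
  apply: eq_integral => x _; rewrite /fubini_F /h/= ge0_integralZl//.
rewrite ge0_integralZr//; last by apply: integral_ge0.
by rewrite !ge0_integral_distribution.
Qed.

End independence.

(** * Strong law for the trace of the squared GOE matrix *)

Section GOE_trace.
Context {d} {T : measurableType d} {R : realType} (P : probability T R).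

Definition GOE_variance (N : nat) (p : 'I_N * 'I_N) : R :=
  (if p.1 == p.2 then 2 else 1) / N%:R.

Lemma GOE_variance_ge0 (N : nat) (p : 'I_N * 'I_N) : 0 <= GOE_variance p.
Proof. by rewrite /GOE_variance divr_ge0//; case: ifP. Qed.

Lemma GOE_variance_ub (N : nat) (p : 'I_N * 'I_N) : GOE_variance p <= 2 / N%:R.
Proof.
rewrite /GOE_variance ler_wpM2r ?invr_ge0//.
by case: ifP => _; rewrite ?ler1n// lexx.
Qed.

Lemma sum_GOE_variance (N : nat) : (0 < N)%N ->
  \sum_(p : 'I_N * 'I_N) GOE_variance p = N.+1%:R.
Proof.
move=> N0; rewrite -(pair_bigA _ (fun i j => GOE_variance (i, j)))/=.
have N0' : N%:R != 0 :> R by rewrite pnatr_eq0 -lt0n.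
rewrite (eq_bigr (fun=> N.+1%:R / N%:R)) => [|i _]; last first.
  rewrite /GOE_variance/= -mulr_suml; congr (_ / _).
  rewrite (bigD1 i)//= eqxx (eq_bigr (fun=> 1)) => [|j ji]; last first.
    by rewrite eq_sym (negbTE ji).
  rewrite sumr_const (@eq_card _ _ (predC1 i))// cardC1 card_ord.
  by rewrite -natrD; congr (_%:R); case: N N0 {i N0'}.
by rewrite sumr_const card_ord -[LHS]mulr_natr divfK.
Qed.

Section fixed_dimension.
Variables (N : nat) (G : T -> 'M[R]_N).
Hypotheses (N0 : (0 < N)%N) (GOE : is_GOE P G).
Implicit Types p q : 'I_N * 'I_N.

Let Y p w : R := G w p.1 p.2.

Let mY p : measurable_fun setT (Y p).
Proof. by case: GOE => _ mG _ _ _; exact: mG. Qed.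

Let Ym p : {mfun T >-> R} := HB.pack (Y p) (isMeasurableFun.Build _ _ _ _ _ (mY p)).

(** [is_GOE] gives independence only on and above the diagonal. Each position is represented by its
    mirror image there, which carries the same entry. *)
Let up p := if (p.1 <= p.2)%N then p else (p.2, p.1).

Let Yup p w : Y (up p) w = Y p w.
Proof.
rewrite /up /Y; case: ifP => //= _.
by case: GOE => /(_ w) {2}<- _ _ _ _; rewrite mxE.
Qed.

Let up_le p : ((up p).1 <= (up p).2)%N.
Proof. by rewrite /up; case: ifP => //= /negbT; rewrite -ltnNge => /ltnW. Qed.

Let up_eq p q : up p = up q -> q = p \/ q = (p.2, p.1).
Proof.
case: p q => [a b] [c e]; rewrite /up/=; case: ifP => _; case: ifP => _ [-> ->];
  by [left | right].
Qed.

Lemma GOE_ge0_integral p (f : R -> \bar R) :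
  measurable_fun setT f -> (forall x, 0 <= f x)%E ->
  (\int[P]_w f (G w p.1 p.2) =
   \int[normal_prob 0 (Num.sqrt (GOE_variance p))]_x f x)%E.
Proof.
move=> mf f0.
pose Yp : {mfun T >-> measurableTypeR R} :=
  HB.pack (Y p) (isMeasurableFun.Build _ _ T (measurableTypeR R) (Y p) (mY p)).
rewrite -(ge0_integral_distribution Yp)//.
apply: eq_measure_integral => A mA _.
case: GOE => _ _ _ off diag; rewrite /GOE_variance.
have [e|ne] := eqVneq p.1 p.2; last exact: off.
by have := diag p.1 A mA; rewrite {2}e; exact.
Qed.

Lemma GOE_sqr p : (\int[P]_w (G w p.1 p.2 ^+ 2)%:E = (GOE_variance p)%:E)%E.
Proof.
rewrite (GOE_ge0_integral p (f := fun x => (x ^+ 2)%:E)); last 2 first.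
- by apply/measurable_EFinP; exact: measurable_funX.
- by move=> x; rewrite lee_fin sqr_ge0.
rewrite normal_prob_sqr ?sqr_sqrtr ?GOE_variance_ge0//.
by rewrite sqrtr_gt0 divr_gt0 ?ltr0n//; case: ifP.
Qed.

Lemma GOE_exp4_ub p :
  (\int[P]_w (G w p.1 p.2 ^+ 2 * G w p.1 p.2 ^+ 2)%:E <= (116 / N%:R ^+ 2)%:E)%E.
Proof.
rewrite (GOE_ge0_integral p (f := fun x => (x ^+ 2 * x ^+ 2)%:E)); last 2 first.
- by apply/measurable_EFinP; apply: measurable_funM; exact: measurable_funX.
- by move=> x; rewrite lee_fin -exprMn sqr_ge0.
apply: le_trans (normal_prob_exp4_ub _) _.
  by rewrite sqrtr_gt0 divr_gt0 ?ltr0n//; case: ifP.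
rewrite lee_fin (exprM _ 2 2) sqr_sqrtr ?GOE_variance_ge0//.
(* The largest variance is [2 / N%:R], on the diagonal, whence 116 = 29 * 4. *)
apply: (@le_trans _ _ (29 * (2 / N%:R) ^+ 2)).
  by rewrite ler_pM2l// ler_pXn2r ?nnegrE ?GOE_variance_ge0// GOE_variance_ub.
by rewrite le_eqVlt; apply/orP; left; apply/eqP; field; rewrite pnatr_eq0 -lt0n.
Qed.

Lemma GOE_independent p q : q != p -> q != (p.2, p.1) ->
  (\int[P]_w (G w p.1 p.2 ^+ 2 * G w q.1 q.2 ^+ 2)%:E =
   (GOE_variance p * GOE_variance q)%:E)%E.
Proof.
move=> qp qpt; under eq_integral do rewrite EFinM.
have upq : up p != up q.
  by apply/eqP => /up_eq[] /eqP; [exact/negP|exact/negP].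
rewrite EFinM -!GOE_sqr.
apply: (ge0_integral_independent (X := Ym p) (Y := Ym q)
  (f := fun x => (x ^+ 2)%:E) (g := fun x => (x ^+ 2)%:E)).
- move=> A B mA mB /=.
  have e r : Y r = Y (up r) by apply/funext => w; rewrite Yup.
  rewrite (e p) (e q).
  case: GOE => _ _ indep _ _.
  (* Mutual independence is applied to the two representatives, with [A] at [up p] and [B] at
     [up q]. *)
  pose C r := if r == up p then A else B.
  have := indep [set up p; up q]%SET _ C _.
  rewrite !big_setU1 ?inE//= !big_set1 /C eqxx eq_sym (negbTE upq); apply.
    by apply/fintype.subsetP => r; rewrite !inE => /orP[] /eqP ->; exact: up_le.
  by move=> r; case: ifP.
- by apply/measurable_EFinP; exact: measurable_funX.
- by apply/measurable_EFinP; exact: measurable_funX.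
- by move=> x; rewrite lee_fin sqr_ge0.
- by move=> x; rewrite lee_fin sqr_ge0.
Qed.

Lemma GOE_mxtrace_sqr w : \tr (G w *m G w) = \sum_p Y p w ^+ 2.
Proof.
rewrite -(pair_bigA _ (fun i j => Y (i, j) w ^+ 2))/= /mxtrace.
apply: eq_bigr => i _; rewrite mxE; apply: eq_bigr => j _.
by case: GOE => /(_ w) {2}<- _ _ _ _; rewrite mxE.
Qed.

Lemma measurable_GOE_mxtrace_sqr : measurable_fun setT (fun w => \tr (G w *m G w)).
Proof.
under eq_fun do rewrite GOE_mxtrace_sqr.
by apply: measurable_sum => p; exact: measurable_funX.
Qed.

Lemma GOE_mxtrace_sqr_ge0 w : 0 <= \tr (G w *m G w).
Proof. by rewrite GOE_mxtrace_sqr sumr_ge0// => p _; exact: sqr_ge0. Qed.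

Lemma GOE_mean : (\int[P]_w (\tr (G w *m G w))%:E = N.+1%:R%:E)%E.
Proof.
under eq_integral do rewrite GOE_mxtrace_sqr -sumEFin.
rewrite ge0_integral_sum//; last 2 first.
- by move=> p; apply/measurable_EFinP; exact: measurable_funX.
- by move=> p w _; rewrite lee_fin sqr_ge0.
under eq_bigr do rewrite GOE_sqr.
by rewrite sumEFin sum_GOE_variance.
Qed.

(* The pairs p, q of entries that are not independent are those with q = p or q
   the transpose of p. *)
Lemma GOE_second_moment :
  (\int[P]_w ((\tr (G w *m G w)) ^+ 2)%:E <= (N.+1%:R ^+ 2 + 232)%:E)%E.
Proof.
have -> : (\int[P]_w ((\tr (G w *m G w)) ^+ 2)%:E =
    \int[P]_w \sum_p \sum_q (Y p w ^+ 2 * Y q w ^+ 2)%:E)%E.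
  apply: eq_integral => w _; rewrite GOE_mxtrace_sqr expr2 mulr_suml -sumEFin.
  by apply: eq_bigr => p _; rewrite mulr_sumr -sumEFin.
have mYY p q : measurable_fun setT (fun w => (Y p w ^+ 2 * Y q w ^+ 2)%:E).
  by apply/measurable_EFinP; apply: measurable_funM; exact: measurable_funX.
have YY0 p q w : (0 <= (Y p w ^+ 2 * Y q w ^+ 2)%:E)%E.
  by rewrite lee_fin mulr_ge0 ?sqr_ge0.
rewrite ge0_integral_sum//; last 2 first.
- by move=> p; exact: emeasurable_sum.
- by move=> p w _; exact: sume_ge0.
pose t := 116 / N%:R ^+ 2 : R.
have t0 : 0 <= t by rewrite divr_ge0 ?sqr_ge0.
(* A bound for every mixed moment: the independent value, plus the fourth-moment bound [t] at each
   of the two exceptional [q]. For diagonal [p] these coincide and [t] is added twice, which is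
   harmless. Summation gives the squared mean plus [2 * N ^ 2 * t], and the latter is 232. *)
pose e p q := GOE_variance p * GOE_variance q
  + (if q == p then t else 0) + (if q == (p.2, p.1) then t else 0).
apply: (@le_trans _ _ (\sum_p \sum_q (e p q)%:E)%E).
  apply: lee_sum => p _; rewrite ge0_integral_sum//.
  apply: lee_sum => q _; rewrite /e.
  have [->|qp] := eqVneq q p.
    apply: le_trans (GOE_exp4_ub p) _; rewrite lee_fin -/t.
    by rewrite addrAC lerDr addr_ge0 ?mulr_ge0 ?GOE_variance_ge0//; case: ifP.
  have [->|qpt] := eqVneq q (p.2, p.1).
    rewrite [leLHS](_ : _ = \int[P]_w (G w p.1 p.2 ^+ 2 * G w p.1 p.2 ^+ 2)%:E)%E.
      apply: le_trans (GOE_exp4_ub p) _; rewrite lee_fin -/t.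
      by rewrite lerDr addr0 mulr_ge0 ?GOE_variance_ge0.
    apply: eq_integral => w _; rewrite /Y/=; congr ((_ * _ ^+ 2)%:E).
    by case: GOE => /(_ w) {1}<- _ _ _ _; rewrite mxE.
  by rewrite GOE_independent// !addr0.
under eq_bigr do rewrite sumEFin.
rewrite sumEFin lee_fin /e.
under eq_bigr do rewrite !big_split/= -!big_mkcond/= !big_pred1_eq -mulr_sumr.
rewrite !big_split/= -mulr_suml sum_GOE_variance// -expr2 -addrA lerD2l.
rewrite !sumr_const card_prod card_ord -mulr2n -mulrnA /t.
rewrite -[leLHS]mulr_natr !natrM le_eqVlt; apply/orP; left; apply/eqP.
by field; rewrite pnatr_eq0 -lt0n.
Qed.

(** By [GOE_mean] this is a variance. The squared mean cancels against [GOE_second_moment], leaving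
    a bound uniform in [N]. *)
Lemma GOE_variance_trace :
  (\int[P]_w ((\tr (G w *m G w) - N.+1%:R) ^+ 2)%:E <= 232%:E)%E.
Proof.
pose S w := \tr (G w *m G w); set m : R := N.+1%:R.
have mS : measurable_fun setT S := measurable_GOE_mxtrace_sqr.
have S0 w : 0 <= S w := GOE_mxtrace_sqr_ge0 w.
have m0 : 0 <= m by [].
have mSm : measurable_fun setT (fun w => ((S w - m) ^+ 2)%:E).
  by apply/measurable_EFinP; apply: measurable_funX; exact: measurable_funB.
(* (S - m)^2 + 2 m S = S^2 + m^2 keeps all integrands nonnegative. *)
have : (\int[P]_w (((S w - m) ^+ 2)%:E + (2 * m)%:E * (S w)%:E)
    = \int[P]_w ((S w ^+ 2)%:E + (m ^+ 2)%:E))%E.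
  by apply: eq_integral => w _; rewrite -EFinM -!EFinD; congr EFin; ring.
rewrite ge0_integralD//; last 3 first.
- by move=> w _; rewrite lee_fin sqr_ge0.
- by move=> w _; rewrite -EFinM lee_fin !mulr_ge0.
- by apply: emeasurable_funM => //; exact/measurable_EFinP.
rewrite ge0_integralD//; last 3 first.
- by move=> w _; rewrite lee_fin sqr_ge0.
- by apply/measurable_EFinP; exact: measurable_funX.
- by move=> w _; rewrite lee_fin sqr_ge0.
rewrite integral_cst// [X in (_ * X)%E](probability_setT P) mule1 ge0_integralZl//; last 3 first.
- exact/measurable_EFinP.
- by move=> w _; rewrite lee_fin.
- by rewrite lee_fin mulr_ge0.
rewrite GOE_mean => E.
have fin : ((2 * m)%:E * m%:E)%E \is a fin_num by [].
rewrite -(@leeD2rE _ _ _ _ fin) E.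
apply: (@le_trans _ _ ((m ^+ 2 + 232)%:E + (m ^+ 2)%:E)%E).
  by rewrite leeD2r//; exact: GOE_second_moment.
by rewrite -EFinM -!EFinD lee_fin; lra.
Qed.

End fixed_dimension.
End GOE_trace.

Section strong_law.
Context {d} {T : measurableType d} {R : realType} (P : probability T R).

Lemma sum_inv_sqr_ub (n : nat) : \sum_(i < n) i.+1%:R ^- 2 <= 2 :> R.
Proof.
case: n => [|n]; first by rewrite big_ord0.
(* The sharper bound passes through the induction because
   [1 / (x + 1) ^ 2 <= 1 / x - 1 / (x + 1)]. *)
suff : \sum_(i < n.+1) i.+1%:R ^- 2 <= 2 - n.+1%:R^-1 :> R.
  by move/le_trans; apply; rewrite gerBl.
elim: n => [|n ih]; first by rewrite big_ord1 expr1n invr1; lra.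
rewrite big_ord_recr/=; apply: (le_trans (lerD ih (lexx _))).
have n0 : 0 < n.+1%:R :> R by [].
rewrite -[n.+2]addn1 natrD; move: (n.+1%:R : R) n0 => x x0.
rewrite -subr_ge0 [leRHS](_ : _ = (x * (x + 1) ^+ 2)^-1).
  by rewrite invr_ge0 mulr_ge0 ?sqr_ge0//; lra.
by field; rewrite !gt_eqF//; lra.
Qed.

(** After exchanging sum and integral, the series of the [f n] has finite integral, so it converges
    almost everywhere and its terms tend to 0. This replaces Chebyshev and Borel-Cantelli. *)
Lemma ae_cvg0_of_summable_integral (f : nat -> T -> R) :
  (forall n, measurable_fun setT (f n)) -> (forall n w, 0 <= f n w) ->
  (\sum_(n <oo) \int[P]_w (f n w)%:E < +oo)%E ->
  {ae P, forall w, f ^~ w @ \oo --> (0 : R)}.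
Proof.
move=> mf f0 foo.
have mF n : measurable_fun setT (EFin \o f n) by exact/measurable_EFinP.
have : P.-integrable setT (fun w => \sum_(n <oo) (f n w)%:E)%E.
  apply/integrableP; split.
    apply: (@ge0_emeasurable_sum _ _ _ setT (fun n w => (f n w)%:E) xpredT).
      by move=> n w _ _; rewrite lee_fin.
    by move=> n _; exact: mF.
  under eq_integral => w _.
    rewrite gee0_abs; last by apply: nneseries_ge0 => n _ _; rewrite lee_fin.
    over.
  by rewrite integral_nneseries// => n w _; rewrite lee_fin.
move=> /(integrable_ae measurableT); apply: filterS => w /(_ Logic.I) fin.
apply: cvg_series_cvg_0; apply: nondecreasing_is_cvgn.
  by apply: nondecreasing_series => n _ _; exact: f0.
exists (fine (\sum_(n <oo) (f n w)%:E)%E) => _ [n _ <-].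
rewrite -lee_fin fineK// /series/= -sumEFin.
by apply: nneseries_lim_ge => k _ _; rewrite lee_fin.
Qed.

Lemma GOE_strong_law (G : forall N : nat, T -> 'M[R]_N) :
  (forall N, is_GOE P (G N)) ->
  {ae P, forall w, (fun N => \tr (G N w *m G N w) / N%:R) @ \oo --> (1 : R)}.
Proof.
move=> GOE.
(* The squared deviation in dimension [n.+1]; the shift avoids dividing by 0. Its integral is at
   most 232 times an inverse square, so the total is at most 232 * 2 = 464. *)
pose Z n w := ((\tr (G n.+1 w *m G n.+1 w) - n.+2%:R) / n.+1%:R) ^+ 2.
have mZ n : measurable_fun setT (Z n).
  apply: measurable_funX; apply: measurable_funM => //.
  by apply: measurable_funB => //; exact: measurable_GOE_mxtrace_sqr (GOE _).
have Z0 n w : 0 <= Z n w by exact: sqr_ge0.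
have IZ n : (\int[P]_w (Z n w)%:E <= (232 * n.+1%:R ^- 2)%:E)%E.
  rewrite [leLHS](_ : _ = \int[P]_w ((n.+1%:R ^- 2)%:E *
      ((\tr (G n.+1 w *m G n.+1 w) - n.+2%:R) ^+ 2)%:E))%E; last first.
    by apply: eq_integral => w _; rewrite /Z -EFinM exprMn exprVn mulrC.
  rewrite ge0_integralZl//.
  - by rewrite [in leRHS]mulrC EFinM lee_pmul2l ?lte_fin// GOE_variance_trace.
  - apply/measurable_EFinP; apply: measurable_funX; apply: measurable_funB => //.
    exact: measurable_GOE_mxtrace_sqr (GOE _).
  - by move=> w _; rewrite lee_fin sqr_ge0.
have : (\sum_(n <oo) \int[P]_w (Z n w)%:E < +oo)%E.
  apply: (@le_lt_trans _ _ 464%:E); last exact: ltry.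
  apply: lime_le.
    by apply: is_cvg_nneseries => n _ _; apply: integral_ge0 => w _; rewrite lee_fin.
  near=> n; apply: (@le_trans _ _ (\sum_(0 <= i < n) (232 * i.+1%:R ^- 2)%:E)%E).
    by apply: lee_sum => i _; exact: IZ.
  rewrite sumEFin lee_fin -mulr_sumr big_mkord.
  have := sum_inv_sqr_ub n.
  by move: (\sum_(_ < _) _) => s; lra.
move=> /(ae_cvg0_of_summable_integral mZ Z0); apply: filterS => w Zw.
rewrite -cvg_shiftS.
have c0 : (fun n => (\tr (G n.+1 w *m G n.+1 w) - n.+2%:R) / n.+1%:R) @ \oo --> (0:R).
  apply/norm_cvg0P.
  have := cvg_comp _ _ Zw (@sqrt_continuous R 0).
  rewrite sqrtr0; apply: cvg_trans; apply: near_eq_cvg; near=> n.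
  by rewrite /Z /= sqrtr_sqr.
(* This is the normalised mean [n.+2 / n.+1], to be added back to the deviation. *)
have c1 : (fun n => 1 + @harmonic R n) @ \oo --> (1 + 0 : R).
  by apply: cvgD; [exact: cvg_cst|exact: (@cvg_harmonic R)].
have := cvgD c0 c1; rewrite add0r addr0 => c.
apply: (cvg_trans _ (c _)); apply: near_eq_cvg; near=> n; rewrite !fctE /harmonic/=.
have : n.+1%:R != 0 :> R by [].
rewrite -[n.+2]addn1 natrD; move: (n.+1%:R : R) (\tr _) => x t x0.
by field.
Unshelve. all: by end_near. Qed.

End strong_law.

(** * Eigenvalues and traces *)

Section spectrum.

Lemma prod_XsubC_comp (R : comNzRingType) (n : nat) (l : 'I_n -> R) (p : {poly R}) :
  (\prod_i ('X - (l i)%:P)) \Po p = \prod_i (p - (l i)%:P).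
Proof.
rewrite rmorph_prod/=; apply: eq_bigr => i _.
by rewrite comp_polyB comp_polyX comp_polyC.
Qed.

(* Substituting X^2 turns the characteristic matrix of M^2 into
   (X - M) (X + M), whose determinant is known from that of X - M. *)
Lemma char_poly_sqr (R : idomainType) (n : nat) (M : 'M[R]_n) (l : 'I_n -> R) :
  char_poly M = \prod_i ('X - (l i)%:P) ->
  char_poly (M *m M) = \prod_i ('X - (l i ^+ 2)%:P).
Proof.
move=> cM.
have injX2 : injective (fun p : {poly R} => p \Po 'X^2).
  move=> p q /eqP; rewrite -subr_eq0 -comp_polyB comp_poly_eq0 ?size_polyXn//.
  by rewrite subr_eq0 => /eqP.
apply: injX2 => /=; rewrite prod_XsubC_comp.
have -> : char_poly (M *m M) \Po 'X^2 = char_poly M * \det ('X%:M + map_mx polyC M).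
  rewrite /char_poly -det_mulmx -det_map_mx/=; congr (\det _).
  have -> : map_mx (comp_poly 'X^2) (char_poly_mx (M *m M)) =
      ('X ^+ 2)%:M - map_mx polyC M *m map_mx polyC M.
    rewrite -map_mxM; apply/matrixP => i j; rewrite !mxE comp_polyB comp_polyC.
    by rewrite raddfMn/= comp_polyX.
  rewrite /char_poly_mx mulmxDr !mulmxBl -scalar_mxM -expr2.
  by rewrite scalar_mxC addrA subrK.
have -> : \det ('X%:M + map_mx polyC M) = \prod_i ('X + (l i)%:P).
  (* [X + M] is [X - M] with [X] replaced by [- X], up to sign; the factor [(-1) ^+ n] of the
     determinant is then spread over the [n] linear factors. *)
  have e : 'X%:M + map_mx polyC M = - map_mx (comp_poly (- 'X)) (char_poly_mx M).
    apply/matrixP => i j; rewrite !mxE comp_polyB comp_polyC.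
    by rewrite raddfMn/= comp_polyX mulNrn opprB opprK addrC.
  rewrite e -scaleN1r detZ det_map_mx -/(char_poly M) cM/= prod_XsubC_comp.
  rewrite -{1}(card_ord n) -prodr_const -big_split/=; apply: eq_bigr => i _.
  by rewrite mulN1r opprB opprK addrC.
rewrite cM -big_split/=; apply: eq_bigr => i _.
by rewrite polyC_exp subr_sqr.
Qed.

(** Both sides are minus the coefficient of degree [n - 1]; dimension 0 has no such coefficient and
    is treated apart. *)
Lemma mxtrace_prod_XsubC (R : comNzRingType) (n : nat) (M : 'M[R]_n) (l : 'I_n -> R) :
  char_poly M = \prod_i ('X - (l i)%:P) -> \tr M = \sum_i l i.
Proof.
case: n M l => [|n] M l cM; first by rewrite /mxtrace !big_ord0.
apply: oppr_inj; rewrite -char_poly_trace// cM.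
have -> : \prod_i ('X - (l i)%:P) = \prod_(x <- codom l) ('X - x%:P).
  by rewrite big_map enumT.
have := coefPn_prod_XsubC (ps := codom l); rewrite size_codom card_ord => -> //.
by rewrite big_map enumT.
Qed.

(** Passes from eigenvalues, given only as roots of the characteristic polynomial, to matrix entries
    without diagonalising. *)
Lemma sorted_eigenvalues_tailsq (R : realType) (N : nat) (M : 'M[R]_N) (l : nat -> R) :
  sorted_eigenvalues M l -> tailsq N l 0 = \tr (M *m M).
Proof.
move=> [_ cM]; rewrite /tailsq big_mkord.
by rewrite (mxtrace_prod_XsubC (char_poly_sqr cM)).
Qed.

Lemma mxtrace_sqr_sym_ge0 (R : realFieldType) (n : nat) (M : 'M[R]_n) :
  M^T = M -> 0 <= \tr (M *m M).
Proof.
move=> MT; rewrite /mxtrace sumr_ge0// => i _; rewrite mxE sumr_ge0// => j _.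
by rewrite -{2}MT mxE -expr2 sqr_ge0.
Qed.

(** Orthonormality kills the cross terms. The value does not depend on [N], so it vanishes after
    division by [N]. *)
Lemma mxtrace_spike_sqr (R : realType) (N k : nat) (lam : nat -> R)
    (u : 'I_k -> 'cV[R]_N) :
  (forall i j, (u i)^T *m u j = (i == j)%:R%:M) ->
  \tr (spike lam u *m spike lam u) = \sum_(i < k) lam i ^+ 2.
Proof.
move=> uu; rewrite /spike mulmx_suml raddf_sum/=; apply: eq_bigr => i _.
rewrite mulmx_sumr raddf_sum/= (bigD1 i)//= big1 => [|j ji].
  rewrite addr0 -scalemxAl -scalemxAr scalerA !linearZ/= mulmxA -(mulmxA (u i)) uu.
  by rewrite eqxx mulmx1 mxtrace_mulC uu eqxx mxtrace1 mulr1 expr2.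
rewrite -scalemxAl -scalemxAr !linearZ/= mulmxA -(mulmxA (u i)) uu eq_sym.
by rewrite (negbTE ji) raddf0 mulmx0 mul0mx raddf0 !mulr0.
Qed.

Lemma spike_sym (R : realType) (N k : nat) (lam : nat -> R) (u : 'I_k -> 'cV[R]_N) :
  (spike lam u)^T = spike lam u.
Proof.
rewrite /spike raddf_sum/=; apply: eq_bigr => i _.
by rewrite linearZ/= trmx_mul trmxK.
Qed.

End spectrum.

(** * The trace of the square of a spiked matrix *)

Section spiked_trace.
Context {R : realType}.

(** Expands the nonnegative traces of the squares of [A + e *: G] and [A - e *: G]. The weight [e]
    balances matrices of different size. *)
Lemma mxtrace_mul_sym_ub (n : nat) (A G : 'M[R]_n) (e : R) :
  A^T = A -> G^T = G ->
  `|2 * e * \tr (A *m G)| <= \tr (A *m A) + e ^+ 2 * \tr (G *m G).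
Proof.
move=> AT GT.
have h (x : R) : 0 <= \tr (A *m A) + 2 * x * \tr (A *m G) + x ^+ 2 * \tr (G *m G).
  have -> : \tr (A *m A) + 2 * x * \tr (A *m G) + x ^+ 2 * \tr (G *m G) =
      \tr ((A + x *: G) *m (A + x *: G)).
    rewrite mulmxDr !mulmxDl -!scalemxAl -!scalemxAr scalerA !mxtraceD !mxtraceZ.
    by rewrite (mxtrace_mulC G A); ring.
  by apply: mxtrace_sqr_sym_ge0; rewrite linearD linearZ/= AT GT.
rewrite ler_norml; apply/andP; split.
  by rewrite -subr_ge0 opprK addrC addrAC; exact: h.
rewrite -subr_ge0; have := h (- e); rewrite sqrrN.
by rewrite (_ : 2 * - e * _ = - (2 * e * \tr (A *m G))) 1?addrAC//; ring.
Qed.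

(** The trace of [A ^ 2] stays bounded while that of [G ^ 2] has order [N]. With weight [N ^ (-1/2)]
    in [mxtrace_mul_sym_ub], the cross term divided by [N] is of order [N ^ (-1/2)]. *)
Lemma cvg_mxtrace_perturbed (A G : forall N : nat, 'M[R]_N) (sigma c : R) :
  (forall N, (A N)^T = A N) -> (forall N, (G N)^T = G N) ->
  (\forall N \near \oo, \tr (A N *m A N) = c) ->
  (fun N => \tr (G N *m G N) / N%:R) @ \oo --> (1 : R) ->
  (fun N => \tr ((A N + sigma *: G N) *m (A N + sigma *: G N)) / N%:R) @ \oo
    --> sigma ^+ 2.
Proof.
move=> AT GT Ac G1.
have r0 : (fun N => Num.sqrt (N%:R^-1 : R)) @ \oo --> (0 : R).
  rewrite -cvg_shiftS /=.
  have := cvg_comp _ _ (@cvg_harmonic R) (@sqrt_continuous R 0).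
  by rewrite sqrtr0.
pose cross N := 2 * \tr (A N *m G N) / N%:R.
have cross0 : cross @ \oo --> (0 : R).
  apply/norm_cvg0P.
  have ub : (fun N => Num.sqrt (N%:R^-1 : R) * (c + \tr (G N *m G N) / N%:R)) @ \oo
      --> (0 : R).
    rewrite -(mul0r (c + 1)); apply: cvgM => //.
    by apply: cvgD => //; exact: cvg_cst.
  apply: squeeze_cvgr (cvg_cst 0) ub; near=> N.
  rewrite normr_ge0/=.
  have N0 : 0 < N%:R :> R by rewrite ltr0n; near: N; exact: nbhs_infty_gt.
  have := mxtrace_mul_sym_ub (Num.sqrt N%:R^-1) (AT N) (GT N).
  rewrite (_ : \tr (A N *m A N) = c); last by near: N.
  rewrite /cross; set r := Num.sqrt _.
  have rr : r ^+ 2 = N%:R^-1 by rewrite sqr_sqrtr// invr_ge0 ltW.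
  have r_gt0 : 0 < r by rewrite sqrtr_gt0 invr_gt0.
  move=> h; rewrite -rr (_ : 2 * _ * r ^+ 2 = r * (2 * r * \tr (A N *m G N))); last by ring.
  by rewrite normrM (gtr0_norm r_gt0) ler_pM2l// [_ * r ^+ 2]mulrC.
have cN : (fun N => c * N%:R^-1) @ \oo --> (0 : R).
  by rewrite -(mulr0 c) -cvg_shiftS; apply: cvgMr; exact: cvg_harmonic.
have lim : (fun N => c * N%:R^-1 + sigma * cross N
    + sigma ^+ 2 * (\tr (G N *m G N) / N%:R)) @ \oo --> sigma ^+ 2.
  rewrite -[X in _ --> X](_ : 0 + sigma * 0 + sigma ^+ 2 * 1 = _); last by ring.
  by apply: cvgD; [apply: cvgD => //; exact: cvgMr|exact: cvgMr].
apply: (cvg_trans _ lim); apply: near_eq_cvg; near=> N.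
have <- : \tr (A N *m A N) = c by near: N.
rewrite mulmxDr !mulmxDl -!scalemxAl -!scalemxAr scalerA !mxtraceD !mxtraceZ.
by rewrite (mxtrace_mulC (G N) (A N)) /cross; ring.
Unshelve. all: by end_near. Qed.

End spiked_trace.

(** * Increments of the scores *)

Section GAIC_increments.
Context {R : realType}.
Implicit Types (sigma gamma : R) (l : nat -> R).

Lemma tailsq_recl (N j : nat) l : (j < N)%N -> tailsq N l j = l j ^+ 2 + tailsq N l j.+1.
Proof. by move=> jN; rewrite /tailsq big_ltn. Qed.

Lemma nparamsS (N j : nat) : nparams N j.+1 = nparams N j + (N%:R - j%:R) :> R.
Proof.
rewrite /nparams /=; case: j => [|j] /=; first by rewrite muln0 muln1; lra.
by rewrite !natrM -[j.+2]addn1 -[j.+1]addn1 !natrD; field.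
Qed.

Lemma GAIC_knownS (N j : nat) sigma gamma l : (0 < N)%N -> (j < N)%N -> sigma != 0 ->
  (GAIC_known N sigma gamma l j.+1 - GAIC_known N sigma gamma l j) / N%:R =
  gamma - gamma * j%:R * N%:R^-1 - l j ^+ 2 / (2 * sigma ^+ 2).
Proof.
move=> N0 jN s0; rewrite /GAIC_known nparamsS (tailsq_recl _ jN).
by field; rewrite s0 pnatr_eq0 -lt0n.
Qed.

(** At the estimated variance the quadratic term equals [N * N.+1 / 2] for every [j], so only the
    logarithm and the penalty change. *)
Lemma GAIC_unknownS (N j : nat) gamma l : (0 < N)%N -> (j < N)%N ->
  0 < tailsq N l j.+1 ->
  (GAIC_unknown N gamma l j.+1 - GAIC_unknown N gamma l j) / N%:R =
  gamma - gamma * j%:R * N%:R^-1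
  + N.+1%:R / 2 * ln (tailsq N l j.+1 / tailsq N l j).
Proof.
move=> N0 jN t'0.
have t0 : 0 < tailsq N l j by rewrite (tailsq_recl _ jN) ltr_wpDl ?sqr_ge0.
have cst (t : R) : 0 < t -> N%:R / (2 * (t / N.+1%:R)) * t = N%:R * N.+1%:R / 2.
  move=> t_gt0; have : N.+1%:R != 0 :> R by [].
  by move: (N.+1%:R : R) => m m0; field; rewrite m0 gt_eqF.
rewrite /GAIC_unknown /sigma2_hat nparamsS !cst//.
rewrite !ln_div ?posrE// natrM.
by field; rewrite pnatr_eq0 -lt0n.
Qed.

(** Both bounds are [ln (1 + y) <= y], at [y = x / t] and at [y = - (x / (x + t))]. With [x] a
    squared eigenvalue and [t] the tail after it, they have the same limit once multiplied by
    [N.+1 / 2]. *)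
Lemma ln_ratio_bounds (x t : R) : 0 <= x -> 0 < t ->
  - (x / t) <= ln (t / (x + t)) <= - (x / (x + t)).
Proof.
move=> x0 t0; have xt0 : 0 < x + t by rewrite ltr_wpDl.
apply/andP; split.
  rewrite -[t / (x + t)]invf_div lnV ?posrE ?divr_gt0// lerN2.
  rewrite (_ : (x + t) / t = 1 + x / t); last by field; rewrite gt_eqF.
  apply: le_ln1Dx; apply: lt_le_trans (_ : 0 <= _); first by lra.
  by rewrite divr_ge0// ltW.
rewrite (_ : t / (x + t) = 1 + - (x / (x + t))); last by field; rewrite gt_eqF.
by apply: le_ln1Dx; rewrite ltrN2 ltr_pdivrMr// mul1r ltrDl.
Qed.

Section limits.
Variables (l : nat -> nat -> R) (sigma gamma L : R) (j : nat).
Hypotheses (s0 : 0 < sigma) (lL : (fun N => l N j) @ \oo --> L).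
Hypothesis tail_cvg : (fun N => tailsq N (l N) j / N%:R) @ \oo --> sigma ^+ 2.

Let invN0 : (fun N => N%:R^-1 : R) @ \oo --> (0 : R).
Proof. by rewrite -cvg_shiftS; exact: cvg_harmonic. Qed.

Let l2 : (fun N => l N j ^+ 2) @ \oo --> L ^+ 2.
Proof. exact: (cvg_comp _ _ lL (@exprn_continuous R 2 L)). Qed.

(** The removed eigenvalue converges, so its square divided by [N] vanishes. *)
Lemma cvg_tailsqS : (fun N => tailsq N (l N) j.+1 / N%:R) @ \oo --> sigma ^+ 2.
Proof.
have c : (fun N => tailsq N (l N) j / N%:R - l N j ^+ 2 * N%:R^-1) @ \oo
    --> sigma ^+ 2 - L ^+ 2 * 0 by apply: cvgB => //; exact: cvgM.
rewrite mulr0 subr0 in c; apply: (cvg_trans _ c); apply: near_eq_cvg; near=> N.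
rewrite tailsq_recl; last by near: N; exact: nbhs_infty_gt.
by ring.
Unshelve. all: by end_near. Qed.

Let drift : (fun N => gamma - gamma * j%:R * N%:R^-1) @ \oo --> gamma.
Proof.
rewrite -[X in _ --> X](_ : gamma - gamma * j%:R * 0 = _); last by ring.
by apply: cvgB; [exact: cvg_cst|exact: cvgMr].
Qed.

(** The sequence [t] is left free so that both bounds of [ln_ratio_bounds] are covered, with the
    tail from [j.+1] or from [j] as denominator. *)
Let weighted (t : nat -> R) : (fun N => t N / N%:R) @ \oo --> sigma ^+ 2 ->
  (fun N => N.+1%:R / 2 * - (l N j ^+ 2 / t N)) @ \oo --> - (L ^+ 2 / (2 * sigma ^+ 2)).
Proof.
move=> ts.
have c : (fun N => - ((1 + N%:R^-1) / 2 * (l N j ^+ 2 / (t N / N%:R)))) @ \oo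
    --> - ((1 + 0) / 2 * (L ^+ 2 / sigma ^+ 2)).
  apply: cvgN; apply: cvgM.
    by apply: cvgMl; apply: cvgD => //; exact: cvg_cst.
  by apply: cvgM => //; apply: cvgV => //; rewrite expf_neq0// gt_eqF.
rewrite [X in _ --> X](_ : _ = - (L ^+ 2 / (2 * sigma ^+ 2))) in c; last first.
  by field; rewrite gt_eqF.
apply: (cvg_trans _ c); apply: near_eq_cvg; near=> N.
have N0 : N%:R != 0 :> R.
  by rewrite pnatr_eq0 -lt0n; near: N; exact: nbhs_infty_gt.
by rewrite -[N.+1]addn1 natrD invf_div; move: (t N)^-1 => v; field.
Unshelve. all: by end_near. Qed.

Lemma cvg_GAIC_increment (known : bool) :
  (fun N => (GAIC known N sigma gamma (l N) j.+1 - GAIC known N sigma gamma (l N) j)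
    / N%:R) @ \oo --> gamma - L ^+ 2 / (2 * sigma ^+ 2).
Proof.
case: known => /=.
  have c : (fun N => gamma - gamma * j%:R * N%:R^-1 - l N j ^+ 2 / (2 * sigma ^+ 2))
      @ \oo --> gamma - L ^+ 2 / (2 * sigma ^+ 2).
    by apply: cvgB => //; exact: cvgMl.
  apply: (cvg_trans _ c); apply: near_eq_cvg; near=> N.
  rewrite GAIC_knownS ?gt_eqF//; near: N; exact: nbhs_infty_gt.
have sq0 : 0 < sigma ^+ 2 by rewrite exprn_gt0.
have tpos : \forall N \near \oo, 0 < tailsq N (l N) j.+1.
  near=> N.
  have N0 : 0 < N%:R :> R by rewrite ltr0n; near: N; exact: nbhs_infty_gt.
  suff : 0 < tailsq N (l N) j.+1 / N%:R by rewrite pmulr_lgt0 ?invr_gt0.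
  by near: N; exact: (cvgr_gt _ cvg_tailsqS).
have lnc : (fun N => N.+1%:R / 2 * ln (tailsq N (l N) j.+1 / tailsq N (l N) j))
    @ \oo --> - (L ^+ 2 / (2 * sigma ^+ 2)).
  apply: squeeze_cvgr (weighted cvg_tailsqS) (weighted tail_cvg); near=> N.
  have jN : (j < N)%N by near: N; exact: nbhs_infty_gt.
  have t0 : 0 < tailsq N (l N) j.+1 by near: N.
  rewrite !ler_pM2l ?divr_gt0// (tailsq_recl _ jN).
  exact: ln_ratio_bounds (sqr_ge0 _) t0.
apply: (cvg_trans _ (cvgD drift lnc)); apply: near_eq_cvg; near=> N.
by rewrite GAIC_unknownS//; near: N => //; exact: nbhs_infty_gt.
Unshelve. all: by end_near. Qed.

End limits.
End GAIC_increments.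

(** * The BBP threshold and the position of the minimiser *)

Section strong_consistency.
Context {R : realType}.
Implicit Types (sigma gamma x : R).

(** The difference is [(x - sigma) ^+ 2 / x]. *)
Lemma psi_gt sigma x : 0 < sigma -> sigma < x -> 2 * sigma < psi sigma x.
Proof.
move=> s0 sx; have x0 : 0 < x by exact: lt_trans sx.
rewrite -subr_gt0 /psi (_ : _ - _ = (x - sigma) ^+ 2 / x).
  by rewrite divr_gt0// exprn_gt0// subr_gt0.
by field; rewrite gt_eqF.
Qed.

(** With [c = Num.sqrt (2 * gamma) * sigma], the claim is that [x ^+ 2 - c * x + sigma ^+ 2] is
    positive; [lambda_gamma] is the larger root of this quadratic, whose discriminant is nonnegative
    for [2 < gamma]. *)
Lemma psi_gt_lambda_gamma sigma gamma x : 0 < sigma -> 2 < gamma ->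
  lambda_gamma sigma gamma < x -> Num.sqrt (2 * gamma) * sigma < psi sigma x.
Proof.
rewrite /lambda_gamma /psi_inv; set c := _ * sigma => s0 g2 cx.
have c0 : 0 < c by rewrite mulr_gt0// sqrtr_gt0; lra.
have c2 : c ^+ 2 = 2 * gamma * sigma ^+ 2 by rewrite exprMn sqr_sqrtr//; lra.
have D0 : 0 <= c ^+ 2 - 4 * sigma ^+ 2.
  have : 0 < sigma ^+ 2 by rewrite exprn_gt0.
  by rewrite c2; nra.
move: cx; set r := Num.sqrt _ => cx.
have r0 : 0 <= r := sqrtr_ge0 _.
have r2 : r ^+ 2 = c ^+ 2 - 4 * sigma ^+ 2 by rewrite sqr_sqrtr.
have x0 : 0 < x by lra.
rewrite -subr_gt0 /psi (_ : _ - _ = (x ^+ 2 - c * x + sigma ^+ 2) / x).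
  rewrite divr_gt0//.
  have : r ^+ 2 < (2 * x - c) ^+ 2 by rewrite ltr_pXn2r ?nnegrE//; lra.
  by rewrite r2; nra.
by field; rewrite gt_eqF.
Qed.

Lemma limn_einf_ge_near (u : nat -> \bar R) (a : \bar R) :
  (\forall n \near \oo, a <= u n)%E -> (a <= limn_einf u)%E.
Proof.
move=> [n0 _ h]; rewrite limn_einf_lim; apply: lime_ge; first exact: is_cvg_einfs.
near=> n; apply: le_ereal_inf_tmp => _ [m /= nm <-]; apply: h => /=.
by apply: leq_trans nm; near: n; exact: nbhs_infty_ge.
Unshelve. all: by end_near. Qed.

Lemma limn_esup_le_near (u : nat -> \bar R) (a : \bar R) :
  (\forall n \near \oo, u n <= a)%E -> (limn_esup u <= a)%E.
Proof.
move=> [n0 _ h]; rewrite limn_esup_lim; apply: lime_le; first exact: is_cvg_esups.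
near=> n; apply: ge_ereal_sup => _ [m /= nm <-]; apply: h => /=.
by apply: leq_trans nm; near: n; exact: nbhs_infty_ge.
Unshelve. all: by end_near. Qed.

Section fixed_sample.
Variables (q k : nat) (sigma gamma : R) (known : bool).
Variables (l : nat -> nat -> R) (L : nat -> R) (kh : nat -> nat).
Hypotheses (s0 : 0 < sigma) (kq : (k <= q)%N).
Hypothesis lL : forall j, (j < q)%N -> l ^~ j @ \oo --> L j.
Hypothesis trace_cvg : (fun N => tailsq N (l N) 0 / N%:R) @ \oo --> sigma ^+ 2.
Hypothesis khP : forall N, is_GAIC_minimizer known N q sigma gamma (l N) (kh N).

Lemma cvg_tailsq (j : nat) : (j <= q)%N ->
  (fun N => tailsq N (l N) j / N%:R) @ \oo --> sigma ^+ 2.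
Proof.
elim: j => // j ih jq; apply: (cvg_tailsqS (lL jq)).
exact/ih/ltnW.
Qed.

Let increment N j :=
  (GAIC known N sigma gamma (l N) j.+1 - GAIC known N sigma gamma (l N) j) / N%:R.

Let increment_cvg j : (j < q)%N ->
  increment ^~ j @ \oo --> gamma - L j ^+ 2 / (2 * sigma ^+ 2).
Proof. by move=> jq; apply: cvg_GAIC_increment (lL jq) (cvg_tailsq (ltnW jq)) _. Qed.

(** The limits of the first [k] increments are negative, so eventually the score strictly decreases
    up to [k] and any index below [k] is beaten by its successor. Finitely many indices share one
    threshold in [N]. *)
Lemma near_GAIC_minimizer_ge :
  (forall j, (j < k)%N -> 2 * gamma * sigma ^+ 2 < L j ^+ 2) ->
  \forall N \near \oo, (k <= kh N)%N.
Proof.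
move=> Lgt.
have neg (i : 'I_k) : \forall N \near \oo, increment N i < 0.
  apply: (cvgr_lt _ (increment_cvg (leq_trans (ltn_ord i) kq))).
  rewrite subr_lt0 ltr_pdivlMr ?mulr_gt0 ?exprn_gt0//.
  by rewrite mulrA (mulrC gamma) Lgt.
have {}neg : \forall N \near \oo, forall i : 'I_k, increment N i < 0.
  exact: filter_forall.
near=> N.
have N0 : 0 < N%:R :> R by rewrite ltr0n; near: N; exact: nbhs_infty_gt.
have negN : forall i : 'I_k, increment N i < 0 by near: N.
rewrite leqNgt; apply/negP => khk; have := negN (Ordinal khk).
rewrite /increment/= pmulr_llt0 ?invr_gt0// subr_lt0 ltNge.
by case: (khP N) => _ -> //; exact: leq_trans kq.
Unshelve. all: by end_near. Qed.

(** Mirror image: from [k] on the score eventually increases strictly, so any index above [k] is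
    beaten by its predecessor. *)
Lemma near_GAIC_minimizer_le :
  (forall j, (k <= j < q)%N -> L j ^+ 2 < 2 * gamma * sigma ^+ 2) ->
  \forall N \near \oo, (kh N <= k)%N.
Proof.
move=> Llt.
have pos (i : 'I_q) : \forall N \near \oo, (k <= i)%N -> 0 < increment N i.
  have [ki|_] := leqP k i; last by near=> N.
  near=> N => _; near: N.
  apply: (cvgr_gt _ (increment_cvg (ltn_ord i))).
  rewrite subr_gt0 ltr_pdivrMr ?mulr_gt0 ?exprn_gt0//.
  by rewrite mulrA (mulrC gamma) Llt// ki ltn_ord.
have {}pos : \forall N \near \oo, forall i : 'I_q, (k <= i)%N -> 0 < increment N i.
  exact: filter_forall.
near=> N.
have N0 : 0 < N%:R :> R by rewrite ltr0n; near: N; exact: nbhs_infty_gt.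
have posN : forall i : 'I_q, (k <= i)%N -> 0 < increment N i by near: N.
rewrite leqNgt; apply/negP => khk; have [khq khmin] := khP N.
have k0 : (0 < kh N)%N by exact: leq_ltn_trans khk.
have jq : ((kh N).-1 < q)%N by rewrite prednK.
have := posN (Ordinal jq); rewrite /= -ltnS prednK// => /(_ khk).
rewrite /increment/= pmulr_lgt0 ?invr_gt0// subr_gt0 prednK// ltNge.
by rewrite khmin// ltnW.
Unshelve. all: by end_near. Qed.

End fixed_sample.
End strong_consistency.

Unset Implicit Arguments.

(* Eigenvalues are 0-indexed: ell N w i is the paper's ell_{i+1} for X_N(w);
   lam i is the paper's lambda_{i+1}; u N i is u_{i+1} at dimension N. *)
Theorem theorem2p1
  (R : realType) (d : measure_display) (T : measurableType d)
  (P : probability T R)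
  (q k : nat) (sigma : R) (lam : nat -> R)
  (u : forall N : nat, 'I_k -> 'cV[R]_N)
  (G : forall N : nat, T -> 'M[R]_N)
  (ell : nat -> T -> nat -> R) :
  0 < sigma ->
  (k <= q)%N ->
  (forall i j, (i <= j < k)%N -> lam j <= lam i) ->
  (forall i, (i < k)%N -> sigma < lam i) ->
  (forall N, is_GOE P (G N)) ->
  (forall N, (k <= N)%N -> forall i j : 'I_k,
      (u N i)^T *m u N j = (i == j)%:R%:M) ->
  (forall N w, sorted_eigenvalues (spike lam (u N) + sigma *: G N w) (ell N w)) ->
  {ae P, forall w,
     (forall i, (i < k)%N -> ell^~ w ^~ i @ \oo --> psi sigma (lam i)) /\
     (forall i, (k <= i < q)%N -> ell^~ w ^~ i @ \oo --> 2 * sigma)} ->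
  forall (known : bool) (gamma : R) (khat : nat -> T -> nat),
  (forall N w, is_GAIC_minimizer known N q sigma gamma (ell N w) (khat N w)) ->
  [/\ gamma <= 2 ->
        {ae P, forall w,
           ((k%:R : R)%:E <= limn_einf (fun N => ((khat N w)%:R : R)%:E))%E},
      2 < gamma ->
        {ae P, forall w,
           (limn_esup (fun N => ((khat N w)%:R : R)%:E) <= (k%:R : R)%:E)%E},
      2 < gamma -> lambda_gamma sigma gamma < lam k.-1 ->
        {ae P, forall w,
           ((k%:R : R)%:E <= limn_einf (fun N => ((khat N w)%:R : R)%:E))%E}
    & 2 < gamma -> lambda_gamma sigma gamma < lam k.-1 ->
        {ae P, forall w, (fun N => (khat N w)%:R : R) @ \oo --> (k%:R : R)}].

Proof.
move=> s0 kq lam_dec lam_gt GOE uu eig ell_cvg known gamma khat khP.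
pose L j : R := if (j < k)%N then psi sigma (lam j) else 2 * sigma.
have ae_limits : {ae P, forall w,
    (forall j, (j < q)%N -> (ell^~ w)^~ j @ \oo --> L j) /\
    (fun N => tailsq N (ell N w) 0 / N%:R) @ \oo --> sigma ^+ 2}.
  apply: filterS2 ell_cvg (GOE_strong_law GOE) => w [top bulk] trG; split.
    move=> j jq; rewrite /L; case: ltnP => jk; first exact: top.
    by apply: bulk; rewrite jk.
  under eq_fun do rewrite (sorted_eigenvalues_tailsq (eig _ w)).
  apply: (cvg_mxtrace_perturbed (c := \sum_(i < k) lam i ^+ 2)) => //.
  - by move=> N; exact: spike_sym.
  - by move=> N; case: (GOE N).
  - near=> N; apply: mxtrace_spike_sqr; apply: uu.
    by near: N; exact: nbhs_infty_ge.
have s2 : 0 < sigma ^+ 2 by rewrite exprn_gt0.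
have ge_a : gamma <= 2 -> {ae P, forall w, \forall N \near \oo, (k <= khat N w)%N}.
  move=> g2; apply: filterS ae_limits => w [lL trX].
  apply: (near_GAIC_minimizer_ge s0 kq lL trX (khP ^~ w)) => j jk.
  (* The strict bound [2 * sigma < psi] covers the boundary case too: [2 * gamma * sigma ^+ 2] is at
     most [4 * sigma ^+ 2], with equality at [gamma = 2]. *)
  rewrite /L jk; have := psi_gt s0 (lam_gt _ jk).
  by move: (psi _ _) => y; nra.
have le_b : 2 < gamma -> {ae P, forall w, \forall N \near \oo, (khat N w <= k)%N}.
  move=> g2; apply: filterS ae_limits => w [lL trX].
  apply: (near_GAIC_minimizer_le s0 lL trX (khP ^~ w)) => j /andP[kj _].
  by rewrite /L ltnNge kj/= exprMn; nra.
have ge_c : 2 < gamma -> lambda_gamma sigma gamma < lam k.-1 ->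
    {ae P, forall w, \forall N \near \oo, (k <= khat N w)%N}.
  move=> g2 lamk; apply: filterS ae_limits => w [lL trX].
  apply: (near_GAIC_minimizer_ge s0 kq lL trX (khP ^~ w)) => j jk.
  rewrite /L jk.
  (* [k.-1] indexes the smallest spike, since [j < k] excludes [k = 0]; monotonicity passes the
     bound on to every spike. *)
  have lamj : lambda_gamma sigma gamma < lam j.
    apply: lt_le_trans lamk _; apply: lam_dec.
    by case: (k) jk => // k'; rewrite ltnS leqnn andbT.
  have g0 : 0 <= 2 * gamma by lra.
  rewrite -(sqr_sqrtr g0) -exprMn ltr_pXn2r ?nnegrE//.
  - exact: psi_gt_lambda_gamma.
  - by rewrite mulr_ge0 ?sqrtr_ge0// ltW.
  - by have := psi_gt s0 (lam_gt _ jk); lra.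
split.
- move=> /ge_a; apply: filterS => w h; apply: limn_einf_ge_near.
  by apply: filterS h => N; rewrite lee_fin ler_nat.
- move=> /le_b; apply: filterS => w h; apply: limn_esup_le_near.
  by apply: filterS h => N; rewrite lee_fin ler_nat.
- move=> g2 /(ge_c g2); apply: filterS => w h; apply: limn_einf_ge_near.
  by apply: filterS h => N; rewrite lee_fin ler_nat.
- move=> g2 /(ge_c g2); apply: filterS2 (le_b g2) => w hle hge.
  (* The two eventual inequalities between integers make the estimator eventually equal to [k]. *)
  apply: cvg_near_cst; apply: filterS2 hle hge => N le ge.
  by congr (_%:R); apply/eqP; rewrite eqn_leq le ge.
Unshelve. all: by end_near. Qed.
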